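(* Let $\mathfrak{F}$ be a hereditary formation of finite groups containing all finite nilpotent groups and let $\Gamma\in\{\Gamma_s,\Gamma_{Nc},\Gamma_H\}$. If a finite group $G$ is the product of subgroups $G_1,\dots,G_n$ with $\mathfrak{F}$-hypercentral condition for commutators, then $$\Gamma(G)\subseteq\bigcup_{i=1}^n\Gamma(G_i)\cup\Gamma(\mathfrak{F})_{|G}.$$
   Context: All groups are finite; $\pi(G)$ is the set of prime divisors of $|G|$. Graphs are directed (vertex set plus set of ordered pairs); union and $\subseteq$ are taken on vertex and edge sets. $O_{p',p}(G)$ is the largest normal $p$-nilpotent subgroup. The Hawkes graph $\Gamma_H(G)$ has vertex set $\pi(G)$ and edge $(p,q)$ iff $q\in\pi(G/O_{p',p}(G))$. The Sylow graph $\Gamma_s(G)$ has vertex set $\pi(G)$ and edge $(p,q)$ iff $q\in\pi(N_G(P)/PC_G(P))$ for some Sylow $p$-subgroup $P$. A Schmidt $(p,q)$-group is a non-nilpotent group all of whose proper subgroups are nilpotent, of order divisible exactly by the primes $p,q$, with a normal Sylow $p$-subgroup; $\Gamma_{Nc}(G)$ has vertex set $\pi(G)$ and edge $(p,q)$ iff $G$ has a Schmidt $(p,q)$-subgroup. For a class $\mathfrak{X}$, $\Gamma(\mathfrak{X})=\bigcup_{X\in\mathfrak{X}}\Gamma(X)$, and $\Gamma(\mathfrak{F})_{|G}$ is the induced subgraph of $\Gamma(\mathfrak{F})$ on $\pi(G)$. A formation is a class closed under homomorphic images and subdirect products; hereditary means closed under subgroups. A chief factor $H/K$ of $G$ is $\mathfrak{F}$-central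 if $(H/K)\rtimes(G/C_G(H/K))\in\mathfrak{F}$; $Z_{\mathfrak{F}}(G)$ is the largest normal subgroup of $G$ all of whose $G$-chief factors below it are $\mathfrak{F}$-central. $G$ is the product of subgroups $G_1,\dots,G_n$ with $\mathfrak{F}$-hypercentral condition for commutators if $G=G_1\cdots G_n$, $G_iG_j$ is a subgroup for all $i,j$, and $[G_i,\prod_{j\ne i}G_j]\le Z_{\mathfrak{F}}(G)$ for all $i$. *)

(* Defs.v *)
From mathcomp Require Import all_boot all_fingroup all_solvable.

Set Implicit Arguments.
Unset Strict Implicit.
Unset Printing Implicit Defensive.

Local Open Scope group_scope.

Record graph := Graph { vert : nat -> Prop; edge : nat -> nat -> Prop }.

Definition graph_sub (A B : graph) : Prop :=
  (forall p, vert A p -> vert B p) /\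
  (forall p q, edge A p q -> edge B p q).

Definition graph_union (A B : graph) : graph :=
  Graph (fun p => vert A p \/ vert B p) (fun p q => edge A p q \/ edge B p q).

Definition graph_bigunion (n : nat) (A : 'I_n -> graph) : graph :=
  Graph (fun p => exists i, vert (A i) p) (fun p q => exists i, edge (A i) p q).

Definition graph_restrict (A : graph) (S : nat -> Prop) : graph :=
  Graph (fun p => vert A p /\ S p) (fun p q => edge A p q /\ S p /\ S q).

Definition group_class := forall gT : finGroupType, {group gT} -> Prop.

Definition iso_closed (F : group_class) : Prop :=
  forall (gT rT : finGroupType) (G : {group gT}) (H : {group rT}),
    G \isog H -> F gT G -> F rT H.

Definition quotient_closed (F : group_class) : Prop :=
  forall (gT : finGroupType) (G N : {group gT}),
    N <| G -> F gT G -> F _ (G / N)%G.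

Definition subdirect_closed (F : group_class) : Prop :=
  forall (gT : finGroupType) (G N1 N2 : {group gT}),
    N1 <| G -> N2 <| G -> F _ (G / N1)%G -> F _ (G / N2)%G ->
    F _ (G / (N1 :&: N2))%G.

Definition formation (F : group_class) : Prop :=
  [/\ iso_closed F, quotient_closed F & subdirect_closed F].

Definition hereditary (F : group_class) : Prop :=
  forall (gT : finGroupType) (G H : {group gT}), H \subset G -> F gT G -> F gT H.

Definition contains_nilpotent (F : group_class) : Prop :=
  forall (gT : finGroupType) (G : {group gT}), nilpotent G -> F gT G.

(* The chief factor H/K of G is F-central iff (H/K) >| (G/C_G(H/K)) is in F,
   where G/C_G(H/K) acts on H/K by conjugation.  The (external) semidirect
   product is realised as an internal one A ><| B = S in some finite group,
   with isomorphisms f : H/K -> A and g : G/C_G(H/K) -> B intertwining the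
   conjugation actions. *)
Definition F_central (F : group_class) (gT : finGroupType)
    (G H K : {group gT}) : Prop :=
  let C := 'C_G(H / K | 'Q)%G in
  exists (sT : finGroupType) (S A B : {group sT})
         (f : {morphism (H / K) >-> sT}) (g : {morphism (G / C) >-> sT}),
    [/\ A ><| B = S, isom (H / K) A f, isom (G / C) B g,
        (forall h x, h \in H -> x \in G ->
           f (coset K (h ^ x)) = f (coset K h) ^ g (coset C x))
      & F sT S].

Definition F_hypercentral (F : group_class) (gT : finGroupType)
    (G Z : {group gT}) : Prop :=
  Z <| G /\
  forall H K : {group gT}, chief_factor G K H -> H \subset Z -> F_central F G H K.

Definition is_F_hypercentre (F : group_class) (gT : finGroupType)
    (G Z : {group gT}) : Prop :=
  F_hypercentral F G Z /\
  forall Z' : {group gT}, F_hypercentral F G Z' -> Z' \subset Z.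

Definition hypercentral_product (F : group_class) (gT : finGroupType)
    (G : {group gT}) (n : nat) (Gs : 'I_n -> {group gT}) : Prop :=
  [/\ (G :=: \prod_(i < n) Gs i),
      (forall i j, group_set (Gs i * Gs j)) &
      exists Z : {group gT}, is_F_hypercentre F G Z /\
        forall i, [~: Gs i, \prod_(j < n | j != i) Gs j] \subset Z].

Definition schmidt_pq (gT : finGroupType) (p q : nat) (H : {group gT}) : Prop :=
  [/\ ~~ nilpotent H,
      (forall K : {group gT}, K \proper H -> nilpotent K),
      (forall r, (r \in \pi(#|H|)) = (r == p) || (r == q)) &
      exists2 P : {group gT}, P \in 'Syl_p(H) & P <| H].

Definition hawkes_graph (gT : finGroupType) (G : {group gT}) : graph :=
  Graph (fun p => p \in \pi(#|G|))
        (fun p q => [/\ p \in \pi(#|G|), q \in \pi(#|G|) &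
                        q \in \pi(#|G / 'O_{p^', p}(G)|)]).

Definition sylow_graph (gT : finGroupType) (G : {group gT}) : graph :=
  Graph (fun p => p \in \pi(#|G|))
        (fun p q => [/\ p \in \pi(#|G|), q \in \pi(#|G|) &
                        exists2 P : {group gT}, P \in 'Syl_p(G) &
                          q \in \pi(#|'N_G(P) / (P * 'C_G(P))|)]).

Definition schmidt_graph (gT : finGroupType) (G : {group gT}) : graph :=
  Graph (fun p => p \in \pi(#|G|))
        (fun p q => [/\ p \in \pi(#|G|), q \in \pi(#|G|) &
                        exists2 H : {group gT}, H \subset G & schmidt_pq p q H]).

Inductive graph_kind := Sylow_kind | Schmidt_kind | Hawkes_kind.

Definition Gamma (k : graph_kind) (gT : finGroupType) (G : {group gT}) : graph :=
  match k with
  | Sylow_kind => sylow_graph G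
  | Schmidt_kind => schmidt_graph G
  | Hawkes_kind => hawkes_graph G
  end.

Definition Gamma_class (k : graph_kind) (F : group_class) : graph :=
  Graph (fun p => exists (xT : finGroupType) (X : {group xT}),
                    F xT X /\ vert (Gamma k X) p)
        (fun p q => exists (xT : finGroupType) (X : {group xT}),
                      F xT X /\ edge (Gamma k X) p q).

(* Main.v *)
(**
Let Z be the F-hypercentre. Modulo Z the factors G_i centralise each other.

Edges (p,q) of the Sylow and Schmidt graphs both say that some q-subgroup Q
normalises but does not centralise a p-subgroup P (a Sylow one for the Sylow
graph). Let D_i be the product of Z and of the G_j with j != i, so that
G / D_i is a quotient of G_i and [D_i, G_i] <= Z. If [P,Q] is not contained in
some D_i, the action survives in G / D_i and lifts to G_i by a Frattini
argument. Otherwise [P,Q,Q] <= Z, so by coprime action Q acts nontrivially on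
P :&: Z, hence on (P :&: H) / K for some chief factor H / K of G below Z, and
the edge appears in the semidirect product of H / K with G / C_G(H / K), which
belongs to F.

For the Hawkes graph, (p,q) is not an edge iff the subgroup D generated by the
q-elements is p-nilpotent. Without such edges in the G_i, D is p-nilpotent
modulo Z, because O_{p',p}(G_i) Z / Z is normal in G / Z. A minimal normal
subgroup of a group X of order divisible by p is centralised by O_{p',p}(X), so
without such edges in F every chief factor of G below Z either is a p'-group or
is centralised by D; p-nilpotence of D then goes down a chief series to 1.
*)
Require Import Defs.
From mathcomp Require Import all_boot all_fingroup all_solvable.

Set Implicit Arguments.
Unset Strict Implicit.
Unset Printing Implicit Defensive.

Local Open Scope group_scope.

(** * Coprime action, and lifting edges from quotients *)

(** [A] acts trivially on [G / [~: G, A]], so by coprimeness ['C_G(A)] covers this quotient. As it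
    also contains [[~: G, A]], it is all of [G]. *)
Lemma coprime_commGG_cents (gT : finGroupType) (A G : {group gT}) :
    A \subset 'N(G) -> coprime #|G| #|A| -> solvable G ->
  A \subset 'C([~: G, A]) -> A \subset 'C(G).
Proof.
move=> nGA coGA solG cRA; set R := [~: G, A]%G.
have sRG : R \subset G by rewrite commg_subl.
have nRG : G \subset 'N(R) by apply: commg_norml.
have nRA : A \subset 'N(R) by apply: commg_normr.
have coRA : coprime #|R| #|A| by apply: coprimeSg coGA.
have := coprime_norm_quotient_cent nGA nRA coRA (solvableS sRG solG).
rewrite (setIidPl (quotient_cents2r (subxx _))) => defC.
have sRC : R \subset 'C_G(A) by rewrite subsetI sRG centsC.
rewrite centsC; apply: subset_trans (subsetIr G _).
by rewrite -(quotientSGK nRG sRC) defC.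
Qed.

(* With [strong = true] this is an edge of the Sylow graph, with
   [strong = false] an edge of the Schmidt graph: see [sylow_graphP] and
   [schmidt_graphP]. *)
Definition pq_action (strong : bool) (p q : nat) (gT : finGroupType) (G : {set gT}) :=
  p != q /\ exists P Q : {group gT},
    [/\ if strong then p.-Sylow(G) P else p.-subgroup(G) P,
        q.-subgroup('N_G(P)) Q & ~~ (Q \subset 'C(P))].

Lemma pq_action_pgroup (strong : bool) p (gT : finGroupType) (G P : {group gT}) :
  (if strong then p.-Sylow(G) P else p.-subgroup(G) P) ->
  P \subset G /\ p.-group P.
Proof. by case: strong => [/and3P[] | /andP[]]. Qed.

Lemma pq_action_pi strong p q (gT : finGroupType) (G : {group gT}) :
  pq_action strong p q G -> p \in \pi(G) /\ q \in \pi(G).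
Proof.
case=> _ [P [Q [/pq_action_pgroup[sPG pP] /andP[]]]].
rewrite subsetI => /andP[sQG _] qQ ncPQ.
have nt1 (r : nat) (R : {group gT}) : R \subset G -> r.-group R -> R :!=: 1 -> r \in \pi(G).
  move=> sRG rR ntR; have [r_pr r_dv _] := pgroup_pdiv rR ntR.
  by rewrite mem_primes r_pr cardG_gt0 (dvdn_trans r_dv) ?cardSg.
split; [apply: (nt1 p P) | apply: (nt1 q Q)] => //.
  by apply: contraNneq ncPQ => ->; rewrite centsC sub1G.
by apply: contraNneq ncPQ => ->; rewrite sub1G.
Qed.

(* [P0] is a Sylow p-subgroup of the preimage of [P], and a Frattini argument
   finds a Sylow q-subgroup of its normaliser that covers [Q] up to conjugacy. *)
Lemma pq_action_quotient strong p q (gT : finGroupType) (H N : {group gT}) :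
  H \subset 'N(N) -> pq_action strong p q (H / N) -> pq_action strong p q H.
Proof.
move=> nNH [p'q [P [Q [sylP sQ ncPQ]]]]; split=> //.
have [sPH pP] := pq_action_pgroup sylP.
have /andP[] := sQ; rewrite subsetI => /andP[sQH nPQ] qQ.
have [sP_PQ sQ_PQ] := joing_sub (erefl (P <*> Q)).
have sPQH : P <*> Q \subset H / N by rewrite join_subG sPH.
pose pre (R : {group coset_of N}) := (H :&: coset N @*^-1 R)%G.
have preK (R : {group coset_of N}) : R \subset H / N -> pre R / N = R.
  by move=> sRH; rewrite quotient_setIpre (setIidPr sRH).
have nsP1L : pre P <| pre (P <*> Q)%G.
  rewrite /normal setIS ?morphpreS //=.
  rewrite normsI //.
    by rewrite (subset_trans (subsetIl _ _)) ?normG.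
  rewrite (subset_trans (subsetIr _ _)) // (subset_trans _ (morphpre_norm _ _)) //.
  by rewrite morphpreS // join_subG normG.
have [P0 sylP0 strP0] : exists2 P0 : {group gT},
    p.-Sylow(pre P) P0 & strong -> p.-Sylow(H) P0.
  case: strong sylP => [sylP | _]; last first.
    by have [P0 sylP0] := Sylow_exists p (pre P); exists P0.
  have [S sylS] := Sylow_exists p H; have sSH := pHall_sub sylS.
  have sylSN := quotient_pHall (subset_trans sSH nNH) sylS.
  have [_ /morphimP[x Nx Hx ->] defP] := Sylow_trans sylSN sylP.
  exists (S :^ x)%G => [|_]; last by rewrite pHallJ.
  rewrite (pHall_subl _ (subsetIl _ _) _) ?pHallJ // subsetI conj_subG //=.
  rewrite -sub_quotient_pre ?conj_subG ?(subset_trans sSH) //.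
  by rewrite defP quotientJ.
have [sP0P1 pP0 _] := and3P sylP0.
have sP0H : P0 \subset H := subset_trans sP0P1 (subsetIl _ _).
have defP : P0 / N = P.
  have := quotient_pHall (subset_trans sP0H nNH) sylP0.
  by rewrite preK // => /pHall_id->.
pose M := 'N_(pre (P <*> Q)%G)(P0)%G.
have sMH : M \subset H by apply: subset_trans (subsetIl _ _) (subsetIl _ _).
have nNM := subset_trans sMH nNH.
have defM : M / N = P <*> Q.
  have sP1N : pre P \subset 'N(N) by rewrite subIset ?nNH.
  have := congr1 (quotient^~ N) (Frattini_arg nsP1L sylP0).
  rewrite /= quotientMl // !preK // mulSGid // -{1}defP quotientS //.
  by rewrite subsetI normG andbT (subset_trans sP0P1 (normal_sub nsP1L)).
have [Q0 sylQ0] := Sylow_exists q M; have [sQ0M qQ0 _] := and3P sylQ0.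
exists P0, Q0; split.
- case: strong strP0 {sylP} => [-> // | _]; exact/andP.
- by rewrite /psubgroup qQ0 andbT (subset_trans sQ0M) // setSI ?subsetIl.
apply: contra ncPQ => cPQ0.
have := quotient_pHall (subset_trans sQ0M nNM) sylQ0; rewrite defM => sylQ0N.
have [x PQx sQQ0] := Sylow_subJ sylQ0N sQ_PQ qQ.
have nPx : x \in 'N(P) by apply: (subsetP _ _ PQx); rewrite join_subG normG.
rewrite (subset_trans sQQ0) // -(normP nPx) centJ conjSg.
by rewrite -defP quotient_cents.
Qed.

(** * Edges of the Sylow and Schmidt graphs as actions of q-groups on p-groups *)

Lemma p'quotient_sub (pi : nat_pred) (gT : finGroupType) (G M Q : {group gT}) :
    Q \subset G -> G \subset 'N(M) -> pi.-group Q -> pi^'.-group (G / M) ->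
  Q \subset M.
Proof.
move=> sQG nMG piQ pi'GM; rewrite -quotient_sub1 ?(subset_trans sQG) //.
rewrite subG1 trivg_card1; apply/eqP; apply: (@pnat_1 pi).
  exact: quotient_pgroup.
by apply: pgroupS pi'GM; apply: quotientS.
Qed.

(** A q-subgroup of ['N_G(P)] centralising [P] lies in [M = P * 'C_G(P)]. Conversely one lying in
    [M] centralises [P] when [p != q], since [M / 'C_G(P)] is a p-group. So q divides
    [|'N_G(P) : M|] exactly when some q-subgroup acts nontrivially. *)
Lemma sylow_graphP (gT : finGroupType) (G : {group gT}) (p q : nat) :
  edge (sylow_graph G) p q <-> pq_action true p q G.
Proof.
have nsM (P : {group gT}) : P <*> 'C_G(P) <| 'N_G(P) \/ ~~ (P \subset G).
  case: (boolP (P \subset G)) => sPG; [left | by right].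
  rewrite /normal join_subG subsetI sPG normG setIS ?cent_sub //=.
  rewrite normsY ?subsetIr // normsI ?norms_cent ?subsetIr //.
  exact: subset_trans (subsetIl _ _) (normG G).
have defM (P : {group gT}) : P * 'C_G(P) = P <*> 'C_G(P).
  by rewrite cent_joinEr ?subsetIr.
split=> [[_ _ [P sylP piq]] | pqG].
  have {}sylP : p.-Sylow(G) P by rewrite inE in sylP.
  have sPG := pHall_sub sylP; have [nsMN | /negP//] := nsM P.
  rewrite defM in piq; set M := (P <*> 'C_G(P))%G in piq nsMN.
  (* A Sylow r-subgroup inside [M] makes the index of [M] prime to r. With [P] this gives [p != q];
     with [Q] it shows that [Q] is not contained in [M]. *)
  have indexM (r : nat) (R : {group gT}) :
    R \subset M -> r.-Sylow('N_G(P)) R -> r != q.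
  - move=> sRM /and3P[_ _ r'R]; apply: contraL piq => /eqP <-.
    rewrite /= -p'groupEpi /pgroup card_quotient ?normal_norm //.
    exact: pnat_dvd (indexgS _ sRM) r'R.
  have [Q sylQ] := Sylow_exists q 'N_G(P); have [sQN qQ _] := and3P sylQ.
  split; first by apply: indexM (joing_subl _ _) _; rewrite Sylow_subnorm.
  exists P, Q; split=> //; first exact/andP.
  apply: contraTN isT => cPQ.
  suff /(indexM q)/(_ sylQ) : Q \subset M by rewrite eqxx.
  apply: subset_trans (joing_subr _ _); rewrite subsetI cPQ andbT.
  exact: subset_trans sQN (subsetIl _ _).
have [piGp piGq] := pq_action_pi pqG.
have [neq_pq [P [Q [sylP /andP[sQN qQ] ncPQ]]]] := pqG.
split=> //; exists P; first by rewrite inE.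
have [sPG pP _] := and3P sylP; have [nsMN | /negP//] := nsM P.
rewrite defM; set M := (P <*> 'C_G(P))%G in nsMN *.
apply: contraR ncPQ; rewrite /= -p'groupEpi => q'NM.
have sQM : Q \subset M by apply: p'quotient_sub q'NM => //; apply: normal_norm.
suff : Q \subset 'C_G(P) by rewrite subsetI => /andP[].
have nCM : M \subset 'N('C_G(P)).
  rewrite join_subG normG andbT normsI ?norms_cent ?normG //.
  exact: subset_trans sPG (normG G).
apply: (p'quotient_sub sQM nCM qQ).
rewrite quotientYidr; last exact: subset_trans (joing_subl _ _) nCM.
by apply: pi_p'group (quotient_pgroup _ pP) _; rewrite !inE eq_sym.
Qed.

(** In a Schmidt group a Sylow q-subgroup centralising the normal Sylow p-subgroup would make the
    group nilpotent. Conversely, if [Q] acts nontrivially on [P], then [P <*> Q] is not nilpotent,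
    and a minimal non-nilpotent subgroup of it is the required Schmidt group. *)
Lemma schmidt_graphP (gT : finGroupType) (G : {group gT}) (p q : nat) :
  edge (schmidt_graph G) p q <-> pq_action false p q G.
Proof.
split=> [[_ _ [H sHG [nnilH _ piH [P sylP nsPH]]]] | pqG].
  have {}sylP : p.-Sylow(H) P by rewrite inE in sylP.
  have [sPH pP p'HP] := and3P sylP.
  have [Q sylQ] := Sylow_exists q H; have [sQH qQ _] := and3P sylQ.
  have neq_pq : p != q.
    apply: contraNneq nnilH => eq_pq; apply: (@pgroup_nil _ p).
    apply/pgroupP=> r r_pr r_dv; have := piH r.
    by rewrite mem_primes r_pr cardG_gt0 r_dv -eq_pq orbb => /esym/eqP->; rewrite inE.
  split=> //; exists P, Q; split.
  - by rewrite /psubgroup pP (subset_trans sPH).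
  - rewrite /psubgroup qQ subsetI (subset_trans sQH) //=.
    by rewrite (subset_trans sQH) // normal_norm.
  apply: contra nnilH => cPQ.
  have sylQ' : p^'.-Hall(H) Q.
    rewrite pHallE sQH (card_Hall sylQ) /=; apply/eqP/eq_in_partn => r.
    rewrite piH => /orP[] /eqP->; rewrite !inE ?eqxx //; last by rewrite eq_sym neq_pq.
    by apply/negbTE.
  have [_ defH _ _] := sdprodP (sdprod_normal_p'HallP nsPH sylQ' sylP).
  by rewrite -defH mulg_nil // (pgroup_nil pP) (pgroup_nil qQ).
have [piGp piGq] := pq_action_pi pqG.
have [neq_pq [P [Q [/andP[sPG pP] /andP[sQN qQ] ncPQ]]]] := pqG.
split=> //; have [sQG nPQ] := subsetIP sQN; pose H := (P <*> Q)%G.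
have sHG : H \subset G by rewrite join_subG sPG.
have defH : H = P * Q :> {set gT} by rewrite /= norm_joinEr.
have p'Q : p^'.-group Q by rewrite (pi_p'group qQ) // !inE eq_sym.
have nnilH : ~~ nilpotent H.
  apply: contra ncPQ => nilH; apply: sub_nilpotent_cent2 nilH _ _ _.
  - exact: joing_subl.
  - exact: joing_subr.
  exact: pnat_coprime pP p'Q.
have [S /mingroupP[nnilS minS] sSH] := @mingroup_exists _ (fun A => ~~ nilpotent A) H nnilH.
exists S; first exact: subset_trans sHG.
have [sylP _] := coprime_mulpG_Hall (esym defH) pP p'Q.
have nsPH : P <| H by rewrite /normal joing_subl join_subG normG.
have sylPS := setI_normal_Hall nsPH sylP sSH.
have sub_piS (r : nat) : r \in \pi(S) -> r = p \/ r = q.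
  rewrite mem_primes => /and3P[r_pr _ r_dv].
  have : r %| #|P| * #|Q|.
    by rewrite (dvdn_trans (dvdn_trans r_dv (cardSg sSH))) // defH mul_cardG dvdn_mulr.
  rewrite Euclid_dvdM // => /orP[] r_dvd; [left | right].
    by move: (pgroupP pP r r_pr r_dvd); rewrite inE => /eqP.
  by move: (pgroupP qQ r r_pr r_dvd); rewrite inE => /eqP.
(* Both primes must occur in [|S|]: otherwise [S] would be a group of prime power order, hence
   nilpotent. *)
have pi_other (r s : nat) : (forall t, t \in \pi(S) -> t = r \/ t = s) -> s \in \pi(S).
  move=> sub_rs; apply: contraR nnilS => s'S; apply: (@pgroup_nil _ r).
  apply/pgroupP=> t t_pr t_dv; have piSt : t \in \pi(S).
    by rewrite mem_primes t_pr cardG_gt0.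
  case: (sub_rs t piSt) => [-> | eq_ts]; first by rewrite inE.
  by rewrite -eq_ts piSt in s'S.
split=> //.
- move=> K /andP[sKS not_sSK]; apply: contraR not_sSK => nnilK.
  by rewrite (minS K).
- move=> r; apply/idP/idP => [/sub_piS[] -> | /orP[] /eqP->].
  + by rewrite eqxx.
  + by rewrite eqxx orbT.
  + by apply: (pi_other q) => t /sub_piS[]; [right | left].
  exact: (pi_other p).
by exists (P :&: S)%G; [rewrite inE | rewrite /= setIC (normalGI sSH)].
Qed.

(** * The semidirect product of a chief factor with the group acting on it *)

Lemma quotient_chief_astab_norm (gT : finGroupType) (G H K : {group gT}) :
  H <| G -> K <| G -> G \subset 'N('C_G(H / K | 'Q)).
Proof.
move=> /andP[_ nHG] /andP[_ nKG].
rewrite normsI ?normG // astabQ.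
apply: subset_trans (morphpre_norm _ _).
by rewrite -sub_quotient_pre // norms_cent ?quotient_norms.
Qed.

Section SemidirectAction.

Variables (gT sT : finGroupType) (G H K : {group gT}) (S A B : {group sT}).
Let C := 'C_G(H / K | 'Q)%G.
Variables (f : {morphism (H / K) >-> sT}) (g : {morphism (G / C) >-> sT}).

Hypotheses (nsHG : H <| G) (nsKG : K <| G).
Hypotheses (defS : A ><| B = S) (isof : isom (H / K) A f) (isog : isom (G / C) B g).
Hypothesis fJ : forall h x, h \in H -> x \in G ->
  f (coset K (h ^ x)) = f (coset K h) ^ g (coset C x).

Lemma semidirect_norms (T X : {group gT}) :
  T \subset H -> X \subset G -> X \subset 'N(T) -> g @* (X / C) \subset 'N(f @* (T / K)).
Proof.
move=> sTH sXG nTX; apply/subsetP=> _ /morphimP[_ _ /morphimP[x _ Xx ->] ->].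
rewrite inE; apply/subsetP=> _ /imsetP[_ /morphimP[_ _ /morphimP[t _ Tt ->] ->] ->].
rewrite -fJ ?(subsetP sTH) ?(subsetP sXG) //.
have Ttx : t ^ x \in T by rewrite memJ_norm // (subsetP nTX).
have nKH : H \subset 'N(K) by rewrite (subset_trans (normal_sub nsHG)) ?normal_norm.
by rewrite mem_morphim ?mem_quotient // (subsetP sTH).
Qed.

Lemma semidirect_cents (T X : {group gT}) :
    T \subset H -> X \subset G -> X \subset 'N(T) ->
  g @* (X / C) \subset 'C(f @* (T / K)) -> X / K \subset 'C(T / K).
Proof.
move=> sTH sXG nTX cTX; have [injf _] := isomP isof.
have nKG := normal_norm nsKG; have nKH := subset_trans (normal_sub nsHG) nKG.
have nCG : G \subset 'N(C) := quotient_chief_astab_norm nsHG nsKG.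
apply/centsP=> _ /morphimP[x Nx Xx ->] _ /morphimP[t Nt Tt ->].
have [Gx Ht] := (subsetP sXG x Xx, subsetP sTH t Tt).
have Htx : t ^ x \in H by rewrite memJ_norm // (subsetP (normal_norm nsHG)).
apply/commute_sym/commgP/conjg_fixP; rewrite -morphJ //.
apply: (injmP injf); rewrite ?mem_quotient // fJ //.
apply/conjg_fixP/commgP/commute_sym/(centsP cTX).
  by rewrite mem_morphim ?mem_quotient.
by rewrite mem_morphim ?mem_quotient.
Qed.

(** The image [P1] of [P :&: H] in [A] carries the nontrivial action of [Q]. Joining the image [P2]
    of [P] in [B] turns it into a Sylow subgroup of [S] when [P] is Sylow in [G], as [P1] is then
    Sylow in [A] and [P2] in [B]. *)
Lemma semidirect_pq_action (strong : bool) (p q : nat) (P Q : {group gT}) :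
    p != q -> (if strong then p.-Sylow(G) P else p.-subgroup(G) P) ->
    q.-subgroup('N_G(P)) Q -> ~~ (Q / K \subset 'C((P :&: H) / K)) ->
  pq_action strong p q S.
Proof.
move=> neq_pq strP /andP[]; rewrite subsetI => /andP[sQG nPQ] qQ ncPQ.
have [sPG pP] := pq_action_pgroup strP.
have nKG := normal_norm nsKG; have nHG := normal_norm nsHG.
have nCG : G \subset 'N(C) := quotient_chief_astab_norm nsHG nsKG.
have [injf defA] := isomP isof; have [injg defB] := isomP isog.
have [_ defAB nAB tiAB] := sdprodP defS.
have sPHH := subsetIr P H; have sPHP := subsetIl P H.
pose P1 := (f @* ((P :&: H) / K))%G; pose P2 := (g @* (P / C))%G; pose Q2 := (g @* (Q / C))%G.
have sP1A : P1 \subset A by rewrite -defA morphimS ?quotientS.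
have sP2B : P2 \subset B by rewrite -defB morphimS ?quotientS.
have sQ2B : Q2 \subset B by rewrite -defB morphimS ?quotientS.
have nP1P2 : P2 \subset 'N(P1).
  by apply: semidirect_norms => //; rewrite normsI ?normG ?(subset_trans sPG).
have nPHQ : Q \subset 'N(P :&: H) by exact: normsI nPQ (subset_trans sQG nHG).
have nP1Q2 : Q2 \subset 'N(P1) by apply: semidirect_norms.
have nP2Q2 : Q2 \subset 'N(P2) by exact: morphim_norms (quotient_norms _ nPQ).
have pP1 : p.-group P1 by apply: morphim_pgroup (quotient_pgroup _ (pgroupS sPHP pP)).
have pP2 : p.-group P2 by apply: morphim_pgroup (quotient_pgroup _ pP).
have [sAS sBS] : A \subset S /\ B \subset S by rewrite -defAB mulG_subl mulG_subr.
split=> //; exists (P1 <*> P2)%G, Q2; split.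
- have pP12 : p.-group (P1 <*> P2) by rewrite norm_joinEr // pgroupM pP1.
  have sP12S : P1 <*> P2 \subset S by rewrite join_subG (subset_trans sP1A) ?(subset_trans sP2B).
  case: strong strP => [sylP | _]; last exact/andP.
  have sylP1 : p.-Sylow(A) P1.
    rewrite -defA; apply: morphim_pHall; first exact: quotientS.
    apply: quotient_pHall; first by rewrite (subset_trans sPHP) ?(subset_trans sPG).
    by rewrite /= setIC (Sylow_setI_normal nsHG).
  have sylP2 : p.-Sylow(B) P2.
    rewrite -defB; apply: morphim_pHall; first exact: quotientS.
    by apply: quotient_pHall => //; rewrite (subset_trans sPG).
  rewrite pHallE sP12S -(sdprod_card defS) partnM ?cardG_gt0 //.
  rewrite -(card_Hall sylP1) -(card_Hall sylP2) /= norm_joinEr // TI_cardMg //.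
  by apply/trivgP; rewrite -tiAB setISS.
- rewrite /psubgroup (morphim_pgroup _ (quotient_pgroup _ qQ)) andbT.
  by rewrite subsetI (subset_trans sQ2B) // normsY.
apply: contra ncPQ => cPQ; apply: semidirect_cents => //.
by rewrite centsC (subset_trans (joing_subl _ P2)) // centsC.
Qed.

End SemidirectAction.

(** * Sylow and Schmidt edges arising inside the hypercentre *)

Lemma chief_factor_exists (gT : finGroupType) (G W : {group gT}) :
  W <| G -> W :!=: 1 -> exists K : {group gT}, chief_factor G K W.
Proof.
move=> nsWG ntW; have [|K maxK _] :=
  @maxgroup_exists _ (fun M => (M \proper W) && (G \subset 'N(M))) [1 gT]%G.
  by rewrite proper1G ntW norms1.
by exists K; rewrite /chief_factor nsWG andbT.
Qed.

(** Take [W] minimal among the normal subgroups of [G] inside [Z] with [Q] nontrivial on [P :&: W].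
    For a chief factor [W / K] the action of [Q] on [(P :&: W) / K] is nontrivial, and F-centrality
    moves it into a member of [F]. *)
Lemma hypercentral_pq_action F strong p q (gT : finGroupType)
    (G Z P Q : {group gT}) :
    F_hypercentral F G Z -> p != q ->
    (if strong then p.-Sylow(G) P else p.-subgroup(G) P) ->
    q.-subgroup('N_G(P)) Q -> ~~ (Q \subset 'C(P :&: Z)) ->
  exists (sT : finGroupType) (S : {group sT}), @F sT S /\ pq_action strong p q S.
Proof.
move=> [nsZG hypZ] neq_pq strP sQN ncPZQ.
pose bad (W : {set gT}) := [&& W <| G, W \subset Z & ~~ (Q \subset 'C(P :&: W))].
have [|W /mingroupP[/and3P[nsWG sWZ ncPWQ] minW] _] := @mingroup_exists _ bad Z.
  by rewrite /bad nsZG subxx.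
have [sPG pP] := pq_action_pgroup strP.
have /andP[] := sQN; rewrite subsetI => /andP[sQG nPQ] qQ.
have ntW : W :!=: 1 by apply: contraNneq ncPWQ => ->; rewrite setIg1 centsC sub1G.
have [K chiefK] := chief_factor_exists nsWG ntW.
have /andP[/maxgroupP[/andP[/andP[sKW not_sWK] nKG] _] _] := chiefK.
have nsKG : K <| G by apply/andP; split; first exact: subset_trans sKW (normal_sub nsWG).
have ncPWK : ~~ (Q / K \subset 'C((P :&: W) / K)).
  have sIP := subsetIl P W.
  rewrite centsC quotient_cents2 ?(subset_trans _ nKG) //; last first.
    exact: subset_trans sIP sPG.
  (* If [Q] centralised this quotient, then [[~: P :&: W, Q]] would lie in [P :&: K], which [Q]
     centralises by minimality of [W]; coprime action would make [Q] centralise [P :&: W]. *)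
  apply: contra ncPWQ => sRK.
  have nIQ : Q \subset 'N(P :&: W).
    by apply: normsI nPQ (subset_trans sQG (normal_norm nsWG)).
  have pI := pgroupS sIP pP.
  apply: coprime_commGG_cents => //; last 1 first.
  - have: Q \subset 'C(P :&: K).
      apply: contraR not_sWK => ncPKQ; rewrite -(minW K) //.
      by apply/and3P; split => //; apply: subset_trans sKW sWZ.
    move/subset_trans; apply; apply: centS; rewrite subsetI sRK andbT.
    by apply: subset_trans sIP; rewrite commg_subl.
  - by apply: pnat_coprime pI _; apply: pi_p'group qQ _; rewrite !inE.
  exact: pgroup_sol pI.
have [sT [S [A [B [f [g [defS isof isog fJ FS]]]]]]] := hypZ W K chiefK sWZ.
exists sT, S; split=> //.
exact: (semidirect_pq_action nsWG nsKG defS isof isog fJ neq_pq strP sQN ncPWK).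
Qed.

(** * p-nilpotent normal subgroups and the Hawkes graph *)

Lemma dvdn_index_setI (gT : finGroupType) (A B N : {group gT}) :
  A \subset B -> N <| B -> #|A : A :&: N| %| #|B : N|.
Proof.
move=> sAB /andP[_ nNB]; have nNA := subset_trans sAB nNB.
by rewrite indexgI -!card_quotient // cardSg ?quotientS.
Qed.

Lemma p'quotient_Sylow (q : nat) (gT : finGroupType) (G N Q : {group gT}) :
  G \subset 'N(N) -> q.-Sylow(G) Q -> Q \subset N -> q^'.-group (G / N).
Proof.
move=> nNG /and3P[sQG _ q'GQ] sQN.
rewrite /pgroup card_quotient // -indexgI.
by apply: pnat_dvd q'GQ; rewrite indexgS // subsetI sQG.
Qed.

Lemma pseries2_index (p : nat) (gT : finGroupType) (G : {group gT}) :
  'O_p^'(G) <| 'O_{p^', p}(G) /\ p.-nat #|'O_{p^', p}(G) : 'O_p^'(G)|.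
Proof.
have sNO : 'O_p^'(G) \subset 'O_{p^', p}(G).
  by rewrite -pseries1; apply: (pseries_sub_catl [:: _] [:: _]).
have nsNO : 'O_p^'(G) <| 'O_{p^', p}(G).
  by apply: normalS sNO (gFsub _ _) (gFnormal _ _).
split=> //; rewrite -card_quotient ?normal_norm //.
by rewrite quotient_pseries2; apply: pcore_pgroup.
Qed.

(** Here p-nilpotence of [D] is expressed by a normal p'-subgroup [U] of p-power index. Since [U]
    lies in ['O_p^'(D)], hence in ['O_p^'(G)], the image of [D] in [G / 'O_p^'(G)] is a normal
    p-subgroup. *)
Lemma pseries2_normal_max (p : nat) (gT : finGroupType) (G D U : {group gT}) :
    D <| G -> U <| D -> p^'.-group U -> p.-nat #|D : U| ->
  D \subset 'O_{p^', p}(G).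
Proof.
move=> nsDG nsUD p'U pDU; set N := 'O_p^'(G)%G; have [sDG nDG] := andP nsDG.
have sUN : U \subset N.
  apply: subset_trans (pcore_max p'U nsUD) _.
  by apply: pcore_max (pcore_pgroup _ _) (char_normal_trans (pcore_char _ _) nsDG).
have nND : D \subset 'N(N) := subset_trans sDG (gFnorm _ _).
have [/normal_sub sNO _] := pseries2_index p G.
rewrite -(quotientSGK nND sNO) quotient_pseries2; apply: pcore_max.
  rewrite /pgroup card_quotient // -indexgI.
  by apply: pnat_dvd pDU; rewrite indexgS // subsetI sUN normal_sub.
exact: quotient_normal.
Qed.

(** A Sylow p-subgroup [S] of [U] lies in [M], so it is central. Its Schur-Zassenhaus complement [V]
    is then normal, and [V] is a p'-group of index [|S|]. *)
Lemma central_p'core_index (p : nat) (gT : finGroupType) (U M : {group gT}) :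
  M \subset 'Z(U) -> p^'.-nat #|U : M| -> p.-nat #|U : 'O_p^'(U)|.
Proof.
rewrite subsetI => /andP[sMU cMU] p'UM.
have nMU : U \subset 'N(M) by rewrite cents_norm // centsC.
have [S sylS] := Sylow_exists p U; have [sSU pS _] := and3P sylS.
have sSM : S \subset M.
  by apply: (p'quotient_sub sSU nMU pS); rewrite /pgroup card_quotient.
have cSU : U \subset 'C(S) by rewrite centsC (subset_trans sSM).
have nsSU : S <| U by rewrite /normal sSU cents_norm.
have /splitsP[V /complP[tiSV defU]] := SchurZassenhaus_split (pHall_Hall sylS) nsSU.
have sVU : V \subset U by rewrite -defU mulG_subr.
have nsVU : V <| U.
  rewrite /normal sVU -defU mul_subG ?normG // cents_norm //.
  by rewrite centsC (subset_trans sVU).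
have iV : #|U : V| = #|S|.
  by rewrite -divgS // -defU TI_cardMg // mulnK ?cardG_gt0.
have p'V : p^'.-group V.
  have /and3P[_ _] := sylS; rewrite -divgS // -defU TI_cardMg //.
  by rewrite mulKn ?cardG_gt0.
apply: pnat_dvd pS; rewrite -iV; apply: indexgS.
exact: pcore_max.
Qed.

(** The descent step for p-nilpotence: from [D / M1] to [D / M0] when [M1 / M0] is central in
    [D / M0]. The new [V] is the preimage of ['O_p^'(U / M0)], which is characteristic in [U / M0]
    and so normal in [D / M0]. *)
Lemma p'core_extension_central (p : nat) (gT : finGroupType) (D U M1 M0 : {group gT}) :
    M0 <| D -> M0 \subset M1 -> M1 \subset U -> U <| D ->
    p.-nat #|D : U| -> p^'.-nat #|U : M1| -> [~: M1, D] \subset M0 ->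
  exists V : {group gT},
    [/\ V <| D, M0 \subset V, p.-nat #|D : V| & p^'.-nat #|V : M0|].
Proof.
move=> nsM0D sM01 sM1U nsUD pDU p'UM1 sRM0.
have [sUD _] := andP nsUD; have [_ nM0D] := andP nsM0D.
have nM0U := subset_trans sUD nM0D; have nM0M1 := subset_trans sM1U nM0U.
have nsM0U : M0 <| U by rewrite /normal (subset_trans sM01).
have zM1 : M1 / M0 \subset 'Z(U / M0).
  rewrite subsetI quotientS //= quotient_cents2 //.
  by apply: subset_trans sRM0; apply: commgS.
have p'UM1b : p^'.-nat #|U / M0 : M1 / M0|.
  by rewrite index_quotient_eq // subIset ?sM01 ?orbT.
have pUb := central_p'core_index zM1 p'UM1b.
have nsVb : 'O_p^'(U / M0) <| D / M0.
  exact: char_normal_trans (pcore_char _ _) (quotient_normal _ nsUD).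
have [V defV sM0V nsVD] := inv_quotientN nsM0D nsVb.
have [sVD _] := andP nsVD; have nM0V := subset_trans sVD nM0D.
have sVU : V \subset U.
  by rewrite -(quotientSGK nM0V (subset_trans sM01 sM1U)) -defV pcore_sub.
exists V; split=> //.
  rewrite -(Lagrange_index sUD sVU) pnatM pDU /=.
  rewrite -(@index_quotient_eq _ U M0 V) // -?defV //.
  by rewrite subIset ?sM0V ?orbT.
by rewrite -card_quotient // -defV; apply: pcore_pgroup.
Qed.

(** A normal subgroup of [X] either contains [A] or meets it trivially and so centralises it. This
    settles [N], as [A] is not a p'-group, and leaves the case where [A] lies in [O]. Then [A] is a
    p-group, it meets the centre of a Sylow p-subgroup [S] of [O] nontrivially, and [N] and [S]
    together centralise that intersection; so [A :&: 'C(O)] is nontrivial and equals [A]. *)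
Lemma pseries2_cent_minnormal (p : nat) (gT : finGroupType) (X A : {group gT}) :
    minnormal A X -> A \subset X -> p \in \pi(A) -> 'O_{p^', p}(X) \subset 'C(A).
Proof.
case/mingroupP=> /andP[ntA nAX] minA sAX piAp.
have [nsNO pON] := pseries2_index p X; set N := 'O_p^'(X)%G in nsNO pON.
set O := 'O_{p^', p}(X)%G in nsNO pON *.
have minA' (Y : {group gT}) : X \subset 'N(Y) -> A \subset Y \/ A :&: Y = 1.
  move=> nYX; case: (eqVneq (A :&: Y) 1) => [-> | ntAY]; [by right | left].
  by rewrite -(minA (A :&: Y)%G) ?subsetIr ?subsetIl // ntAY normsI.
have [nNX nOX] : X \subset 'N(N) /\ X \subset 'N(O) by rewrite !gFnorm.
have [sNX sOX] : N \subset X /\ O \subset X by rewrite !gFsub.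
have cent_TI (Y : {group gT}) : Y \subset X -> X \subset 'N(Y) -> A :&: Y = 1 -> Y \subset 'C(A).
  move=> sYX nYX tiAY; rewrite centsC; apply/commG1P/trivgP; rewrite -tiAY subsetI.
  by rewrite commg_subl commg_subr (subset_trans sYX) // (subset_trans sAX).
have cNA : N \subset 'C(A).
  case: (minA' N nNX) => [sAN | tiAN]; last exact: cent_TI.
  by have := pgroupS sAN (pcore_pgroup _ _); rewrite p'groupEpi piAp.
case: (minA' O nOX) => [sAO | tiAO]; last exact: cent_TI.
have pA : p.-group A.
  have tiAN : A :&: N = 1.
    case: (minA' N nNX) => // sAN.
    by have := pgroupS sAN (pcore_pgroup _ _); rewrite p'groupEpi piAp.
  have nNA := subset_trans sAX nNX.
  rewrite /pgroup -indexg1 -tiAN; apply: pnat_dvd pON; exact: dvdn_index_setI.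
have [S sylS] := Sylow_exists p O; have [sSO pS _] := and3P sylS.
have sAS : A \subset S.
  by rewrite (normal_sub_max_pgroup (Hall_max sylS)) // /normal sAO (subset_trans sOX).
have nsAS : A <| S by rewrite /normal sAS (subset_trans _ nAX) // (subset_trans sSO).
pose B := (A :&: 'Z(S))%G.
have ntB : B :!=: 1 := meet_center_nil (pgroup_nil pS) nsAS ntA.
have cBO : O \subset 'C(B).
  have cBS : S \subset 'C(B) by rewrite centsC /= setIA (subset_trans (subsetIr _ _)).
  have cBN : N \subset 'C(B) by rewrite (subset_trans cNA) // centS ?subsetIl.
  suff : O \subset 'C_O(B) by rewrite subsetI => /andP[].
  (* The index of ['C_O(B)] in [O] is a p-number because it contains [N], and a p'-number because it
     contains [S]. *)
  rewrite -indexg_eq1; apply/eqP/(@pnat_1 p).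
    by apply: pnat_dvd (indexgS O _) pON; rewrite subsetI normal_sub.
  have /and3P[_ _ p'OS] := sylS.
  by apply: pnat_dvd (indexgS O _) p'OS; rewrite subsetI sSO.
have ntC : A :&: 'C(O) != 1.
  apply: contraNneq ntB => tiAC; rewrite -subG1 -tiAC subsetI subsetIl.
  by rewrite centsC.
rewrite centsC -(minA (A :&: 'C(O))%G) ?subsetIr ?subsetIl //.
by rewrite ntC normsI // norms_cent.
Qed.

(** The vertex conditions follow: if p did not divide [|G|], then [G] would equal
    ['O_{p^', p}(G)]. *)
Lemma hawkes_graph_edge (gT : finGroupType) (G : {group gT}) (p q : nat) :
  ~~ q^'.-group (G / 'O_{p^', p}(G)) -> edge (hawkes_graph G) p q.
Proof.
rewrite p'groupEpi negbK => piGOq.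
have dv_GO : #|G / 'O_{p^', p}(G)| %| #|G| by rewrite card_quotient ?gFnorm ?dvdn_indexg.
split=> //; last by apply: (pi_of_dvd dv_GO).
apply: contraLR piGOq; rewrite -!p'groupEpi => p'G.
rewrite /= quotientS1 ?pgroup1 //; apply: (pseries2_normal_max (normal_refl _) (normal_refl _) p'G).
by rewrite indexgg.
Qed.

(** * Hawkes edges arising inside the hypercentre *)

(** A subgroup of [A] normalised by [S] pulls back along [f] to a [G]-invariant subgroup of the
    chief factor [H / K]. *)
Lemma semidirect_minnormal (gT sT : finGroupType) (G H K : {group gT})
    (S A B : {group sT}) (C := 'C_G(H / K | 'Q)%G)
    (f : {morphism (H / K) >-> sT}) (g : {morphism (G / C) >-> sT}) :
    chief_factor G K H -> A ><| B = S -> isom (H / K) A f -> isom (G / C) B g ->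
    (forall h x, h \in H -> x \in G ->
       f (coset K (h ^ x)) = f (coset K h) ^ g (coset C x)) ->
  minnormal A S.
Proof.
move=> chiefK defS isof isog fJ; have [injf defA] := isomP isof.
have /andP[/maxgroupP[/andP[_ nKG] _] nsHG] := chiefK; have [sHG nHG] := andP nsHG.
have /mingroupP[/andP[ntHK _] minHK] := chief_factor_minnormal chiefK.
have [_ defAB nAB _] := sdprodP defS.
have sBS : B \subset S by rewrite -defAB mulG_subr.
apply/mingroupP; split=> [|Y /andP[ntY nYS] sYA].
  rewrite -defA morphim_injm_eq1 // ntHK /= -defAB mul_subG ?defA // normG.
have sYf : Y \subset f @* (H / K) by rewrite defA.
have defY : f @* (f @*^-1 Y) = Y by apply: morphpreK.
rewrite -{1}defY -defA; congr (f @* _); apply: minHK; last exact: subsetIl.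
apply/andP; split.
  by apply: contraNneq ntY => Y1; rewrite -defY Y1 morphim1.
apply/subsetP=> _ /morphimP[x Nx Gx ->]; rewrite inE.
apply/subsetP=> _ /imsetP[_ /morphpreP[/morphimP[h Nh Hh ->] Yfh] ->].
have Hhx : h ^ x \in H by rewrite memJ_norm // (subsetP nHG).
rewrite -morphJ //; apply/morphpreP; split; first exact: mem_quotient.
rewrite fJ // memJ_norm // (subsetP nYS) // (subsetP sBS) //.
by have [_ <-] := isomP isog; rewrite mem_morphim ?mem_quotient.
Qed.

(** If [S] has no edge (p,q), its q-subgroups lie in ['O_{p^', p}(S)], which centralises the minimal
    normal subgroup [A]. The group [S] is produced before this assumption so that it can serve as
    the witness of an edge when the conclusion fails. *)
Lemma F_central_hawkes_cents F (p q : nat) (gT : finGroupType) (G H K : {group gT}) :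
    chief_factor G K H -> F_central F G H K -> p \in \pi(H / K) ->
  exists (sT : finGroupType) (S : {group sT}), F sT S /\
    (q^'.-group (S / 'O_{p^', p}(S)) -> forall Q : {group gT},
       Q \subset G -> q.-group Q -> Q / K \subset 'C(H / K)).
Proof.
move=> chiefK [sT [S [A [B [f [g [defS isof isog fJ FS]]]]]]] piHKp.
exists sT, S; split=> // hawS Q sQG qQ.
have /andP[/maxgroupP[/andP[/andP[sKH _] nKG] _] nsHG] := chiefK.
have nsKG : K <| G by rewrite /normal nKG (subset_trans sKH) ?normal_sub.
have [_ nHG] := andP nsHG.
apply: (semidirect_cents nsHG nsKG isof fJ) => //; first exact: subset_trans sQG nHG.
have [injf defA] := isomP isof; have [injg defB] := isomP isog.
have [_ defAB _ _] := sdprodP defS; rewrite defA.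
have sAS : A \subset S by rewrite -defAB mulG_subl.
have sBS : B \subset S by rewrite -defAB mulG_subr.
have minA := semidirect_minnormal chiefK defS isof isog fJ.
have piAp : p \in \pi(A) by rewrite /= -defA card_injm.
apply: subset_trans (pseries2_cent_minnormal minA sAS piAp).
apply: (p'quotient_sub _ (gFnorm _ _) _ hawS).
  by apply: subset_trans sBS; rewrite -defB morphimS ?quotientS.
exact: morphim_pgroup (quotient_pgroup _ qQ).
Qed.

Lemma hypercentral_hawkes F (p q : nat) (gT : finGroupType) (G Z : {group gT}) :
    F_hypercentral F G Z ->
    q^'.-group ((G / Z) / 'O_{p^', p}(G / Z)) ->
    ~~ q^'.-group (G / 'O_{p^', p}(G)) ->
  exists (sT : finGroupType) (S : {group sT}),
    F sT S /\ ~~ q^'.-group (S / 'O_{p^', p}(S)).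
Proof.
move=> [nsZG hypZ] hawGZ not_hawG; have [sZG nZG] := andP nsZG.
pose gens := [set x in G | q.-elt x]; pose D := <<gens>>%G.
have sDgen (T : {group gT}) :
  (forall Q : {group gT}, Q \subset G -> q.-group Q -> Q \subset T) -> D \subset T.
- move=> sQT; rewrite gen_subG; apply/subsetP=> x; rewrite inE => /andP[Gx qx].
  by rewrite -cycle_subG sQT // cycle_subG.
have sDG : D \subset G by apply: sDgen.
have nsDG : D <| G.
  rewrite /normal sDG norms_gen //; apply/subsetP=> y Gy; rewrite inE.
  apply/subsetP=> _ /imsetP[x /setIdP[Gx qx] ->].
  by rewrite inE groupJ // p_eltJ.
have [_ nDG] := andP nsDG.
(* [red W] says that [D / (D :&: W)] is p-nilpotent, [U] being the preimage of its normal
   p-complement. *)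
pose red (W : {set gT}) := [&& W <| G, W \subset Z & [exists U : {group gT},
  [&& U <| D, D :&: W \subset U, p.-nat #|D : U| & p^'.-nat #|U : D :&: W|]]].
have redZ : red Z.
  rewrite /red nsZG subxx /=.
  (* Without an edge in [G / Z] the image of [D] lies in ['O_{p^', p}(G / Z)], so [U] can be cut out
     of [D] by the preimage of ['O_p^'(G / Z)]. *)
  pose T2 := (coset Z @*^-1 'O_{p^', p}(G / Z))%G.
  pose T := (coset Z @*^-1 'O_p^'(G / Z))%G.
  have [nsOO pOO] := pseries2_index p (G / Z).
  have sDT2 : D \subset T2.
    apply: sDgen => Q sQG qQ; have nZQ := subset_trans sQG nZG.
    rewrite -sub_quotient_pre //.
    apply: (p'quotient_sub _ (gFnorm _ _) _ hawGZ); first exact: quotientS.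
    exact: quotient_pgroup.
  have nsTT2 : T <| T2 by rewrite cosetpre_normal.
  have nsZT : Z <| T.
    by rewrite /normal sub_cosetpre (subset_trans (subsetIl _ _)).
  apply/existsP; exists (D :&: T)%G; apply/and4P; split.
  - exact: (normalGI sDT2 nsTT2).
  - by rewrite setIS // normal_sub.
  - apply: pnat_dvd (dvdn_index_setI sDT2 nsTT2) _.
    by rewrite index_cosetpre.
  have -> : D :&: Z = (D :&: T) :&: Z.
    by rewrite -setIA (setIidPr (normal_sub nsZT)).
  apply: pnat_dvd (dvdn_index_setI (subsetIr D T) nsZT) _.
  rewrite -card_quotient ?normal_norm // cosetpreK; exact: pcore_pgroup.
have [W /mingroupP[/and3P[nsWG sWZ /existsP[U /and4P[nsUD sWU pDU p'UW]]] minW] _] :=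
  @mingroup_exists _ red Z redZ.
have ntW : W :!=: 1.
  (* For [W = 1] the group [D] itself would be p-nilpotent, so ['O_{p^', p}(G)] would contain every
     q-element of [G]. *)
  apply: contraNneq not_hawG => W1.
  rewrite W1 setIg1 indexg1 in p'UW.
  have sDO := pseries2_normal_max nsDG nsUD p'UW pDU.
  have [Q sylQ] := Sylow_exists q G; have [sQG qQ _] := and3P sylQ.
  apply: (p'quotient_Sylow (gFnorm _ _) sylQ); apply: subset_trans sDO.
  apply/subsetP=> x Qx; apply: mem_gen; rewrite inE (subsetP sQG) //.
  exact: mem_p_elt Qx.
have [K chiefK] := chief_factor_exists nsWG ntW.
have /andP[/maxgroupP[/andP[/andP[sKW not_sWK] nKG] _] _] := chiefK.
have nsKG : K <| G by rewrite /normal nKG (subset_trans sKW) ?normal_sub.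
have nsKW : K <| W by rewrite /normal sKW (subset_trans (normal_sub nsWG)).
have nsKD : D :&: K <| D by exact: (normalGI sDG nsKG).
have irred (V : {group gT}) : V <| D -> D :&: K \subset V -> p.-nat #|D : V| ->
  p^'.-nat #|V : D :&: K| -> False.
- move=> nsVD sKV pDV p'VK; case/negP: not_sWK; rewrite -(minW K) //.
  apply/and3P; split=> //; first exact: subset_trans sWZ.
  by apply/existsP; exists V; apply/and4P.
case: (boolP (p \in \pi(W / K))) => [piWKp | ]; last first.
  rewrite -p'groupEpi /pgroup card_quotient ?normal_norm // => p'WK.
  (* When [W / K] is a p'-group, the same [U] works for [K]. *)
  case: (irred U) => //; first by rewrite (subset_trans _ sWU) ?setIS.
  rewrite -(@Lagrange_index _ U (D :&: W) (D :&: K)) ?setIS // pnatM p'UW /=.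
  have -> : D :&: K = (D :&: W) :&: K by rewrite -setIA (setIidPr sKW).
  exact: pnat_dvd (dvdn_index_setI (subsetIr D W) nsKW) p'WK.
have [sT [S [FS hawS_cents]]] :=
  F_central_hawkes_cents q chiefK (hypZ W K chiefK sWZ) piWKp.
exists sT, S; split=> //; apply/negP => /hawS_cents cQW.
(* Now every q-subgroup of [G] centralises [W / K]; these generate [D], so the section of [D]
   between [D :&: K] and [D :&: W] is central. *)
have cDW : [~: W, D] \subset K.
  rewrite commGC.
  have sDC : D \subset G :&: coset K @*^-1 'C(W / K).
    apply: sDgen => Q sQG qQ; rewrite subsetI sQG /=.
    by rewrite -sub_quotient_pre ?cQW // (subset_trans sQG).
  have nKD := subset_trans sDG nKG; have [_ nKW] := andP nsKW.
  rewrite -quotient_cents2 // sub_quotient_pre //.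
  exact: subset_trans sDC (subsetIr _ _).
have [|V [nsVD sKV pDV p'VK]] :=
  p'core_extension_central nsKD (setIS D sKW) sWU nsUD pDU p'UW.
  rewrite subsetI commg_subr (subset_trans (subsetIl _ _) (normG D)) /=.
  exact: subset_trans (commSg _ (subsetIr _ _)) cDW.
exact: (irred V).
Qed.

(** * Products with hypercentral commutators *)

Lemma prod_subG (gT : finGroupType) (n : nat) (I : pred 'I_n) (A : 'I_n -> {group gT})
    (H : {group gT}) :
  (\prod_(i < n | I i) A i)%g \subset H <-> (forall i, I i -> A i \subset H).
Proof.
split=> [sAH i Ii | sAH]; last first.
  by elim/big_ind: _ => [|X Y sXH sYH|i]; [apply: sub1G | apply: mul_subG | apply: sAH].
apply: subset_trans sAH; have : i \in index_enum 'I_n by rewrite mem_index_enum.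
elim: (index_enum _) => // j r IHr; rewrite inE big_cons => /orP[/eqP <- | ri].
  rewrite Ii mulg_subl //; elim/big_ind: _ => [|X Y X1 Y1|k _]; rewrite ?inE //.
  by rewrite -(mulg1 1) mem_mulg.
by case: (I j) => //; last exact: IHr; apply: subset_trans (IHr ri) (mulg_subr _ _).
Qed.

Section HypercentralProduct.

Variables (F : group_class) (gT : finGroupType) (G Z : {group gT}) (n : nat).
Variable Gs : 'I_n -> {group gT}.
Hypotheses (nsZG : Z <| G) (defG : G :=: \prod_(i < n) Gs i).
Hypothesis sRZ : forall i, [~: Gs i, \prod_(j < n | j != i) Gs j] \subset Z.

Lemma factor_subG i : Gs i \subset G.
Proof. by have [] := prod_subG predT Gs G; rewrite -defG => -> //. Qed.

Lemma prod_factor_subG (H : {group gT}) : (forall i, Gs i \subset H) -> G \subset H.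
Proof. by move=> sGH; rewrite defG; apply/prod_subG. Qed.

Let D i := (Z <*> \prod_(j < n | j != i) Gs j)%G.

(** The preimage of the centraliser of [Gs i / Z] is a group containing [Z] and every [Gs j] with
    [j != i], hence all of [D i]. *)
Lemma cofactor_comm i : [~: Gs i, D i] \subset Z.
Proof.
have sGi := factor_subG i; have nZG := normal_norm nsZG.
have nZGi : Gs i \subset 'N(Z) := subset_trans sGi nZG.
have sDG : D i \subset G.
  rewrite join_subG normal_sub //=; apply/prod_subG => j _; exact: factor_subG.
have nZD := subset_trans sDG nZG.
rewrite -quotient_cents2 // centsC sub_quotient_pre // join_subG sub_cosetpre /=.
rewrite -sub_quotient_pre; last first.
  by apply/prod_subG => j _; apply: subset_trans (factor_subG j) nZG.
by rewrite centsC quotient_cents2r.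
Qed.

Lemma sub_cofactor i j : j != i -> Gs j \subset D i.
Proof.
move=> ne_ji; have [sub _] := prod_subG (fun j => j != i) Gs (D i).
exact: sub (joing_subr _ _) j ne_ji.
Qed.

Lemma quotient_cofactor i : D i <| G /\ G / D i = Gs i / D i.
Proof.
have sGi := factor_subG i; have sZD : Z \subset D i := joing_subl _ _.
have nDi : Gs i \subset 'N(D i).
  by rewrite -commg_subr (subset_trans (cofactor_comm i)).
have sG : G \subset Gs i <*> D i.
  apply: prod_factor_subG => j; case: (eqVneq j i) => [-> | ne_ji].
    exact: joing_subl.
  exact: subset_trans (sub_cofactor ne_ji) (joing_subr _ _).
have sDG : D i \subset G.
  rewrite join_subG normal_sub //=; apply/prod_subG => j _; exact: factor_subG.
have nDG : G \subset 'N(D i) by rewrite (subset_trans sG) // join_subG nDi normG.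
split; first exact/andP.
rewrite -(quotientYidr nDi); suff -> : Gs i <*> D i = G by [].
by apply/eqP; rewrite eqEsubset sG join_subG sGi sDG.
Qed.

Lemma product_pq_action strong p q :
    F_hypercentral F G Z -> pq_action strong p q G ->
  (exists i, pq_action strong p q (Gs i)) \/
  (exists (sT : finGroupType) (S : {group sT}), @F sT S /\ pq_action strong p q S).
Proof.
move=> hypZ [neq_pq [P [Q [strP sQN ncPQ]]]].
have [sPG pP] := pq_action_pgroup strP.
have /andP[] := sQN; rewrite subsetI => /andP[sQG nPQ] qQ.
case: (boolP [exists i, ~~ ([~: P, Q] \subset D i)]) => [/existsP[i sRD] | ].
  left; exists i; have [nsDG defGD] := quotient_cofactor i.
  have nDG := normal_norm nsDG.
  apply: (@pq_action_quotient _ _ _ _ _ (D i)).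
    exact: subset_trans (factor_subG i) nDG.
  rewrite -defGD; split=> //; exists (P / D i)%G, (Q / D i)%G; split.
  - case: strong strP => [sylP|_].
      by apply: quotient_pHall => //; apply: subset_trans sPG nDG.
    by rewrite /psubgroup quotientS ?quotient_pgroup.
  - by rewrite /psubgroup quotient_pgroup // subsetI quotientS ?quotient_norms.
  by rewrite centsC quotient_cents2 ?(subset_trans _ nDG).
rewrite negb_exists => /forallP sRD; right.
apply: (hypercentral_pq_action hypZ neq_pq strP sQN).
pose R := [~: P, Q]%G; have sRP : R \subset P by rewrite commg_subl.
have nZG := normal_norm nsZG.
have sRQZ : [~: R, Q] \subset Z.
  have nZR : R \subset 'N(Z) := subset_trans sRP (subset_trans sPG nZG).
  have nZQ := subset_trans sQG nZG.
  rewrite -quotient_cents2 // centsC sub_quotient_pre //; apply: subset_trans sQG _.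
  (* Here [R] lies in every [D i], so each [Gs i], and with them [G], centralises [R] modulo [Z]. *)
  apply: prod_factor_subG => i; have sGi := factor_subG i.
  rewrite -sub_quotient_pre ?(subset_trans sGi) //.
  apply: quotient_cents2r; apply: subset_trans (cofactor_comm i).
  by rewrite commgS //; apply: contraR (sRD i).
apply: contra ncPQ => cPZQ.
have coPQ : coprime #|P| #|Q|.
  by apply: pnat_coprime pP _; apply: pi_p'group qQ _; rewrite !inE.
have nRQ : Q \subset 'N(R) := commg_normr _ _.
(* Coprime action is used twice: [Q] centralises [[~: R, Q]], which lies in [P :&: Z], hence it
   centralises [R], hence [P]. *)
apply: (coprime_commGG_cents nPQ coPQ (pgroup_sol pP)).
apply: (coprime_commGG_cents nRQ _ (pgroup_sol (pgroupS sRP pP))).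
  exact: coprimeSg coPQ.
apply: subset_trans cPZQ _; apply: centS; rewrite subsetI sRQZ andbT.
by apply: subset_trans sRP; rewrite commg_subl.
Qed.

Lemma quotient_factor_normal i : Gs i / Z <| G / Z.
Proof.
have sGi := factor_subG i; have nZG := normal_norm nsZG.
rewrite /normal quotientS // sub_quotient_pre //; apply: prod_factor_subG => j.
rewrite -sub_quotient_pre ?(subset_trans (factor_subG j)) //.
case: (eqVneq i j) => [-> | ne_ij]; first exact: normG.
apply: cents_norm; apply: quotient_cents2r; apply: subset_trans (cofactor_comm j).
by rewrite commgS // sub_cofactor.
Qed.

(** The Sylow q-subgroups of [Gs i / Z] lie in ['O_{p^', p}(Gs i / Z)], which lies in [O] because
    [Gs i / Z] is normal in [E]. So each factor has a normal q'-image in [E / O], and these images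
    together fill [E / O]. *)
Lemma product_hawkes (p q : nat) :
    (forall i, q^'.-group (Gs i / 'O_{p^', p}(Gs i))) ->
  q^'.-group ((G / Z) / 'O_{p^', p}(G / Z)).
Proof.
move=> hawGs; have nZG := normal_norm nsZG.
set E := (G / Z)%G; set O := 'O_{p^', p}(E)%G.
have nOE : E \subset 'N(O) := gFnorm _ _.
suff sEq : E / O \subset 'O_q^'(E / O) by apply: pgroupS sEq (pcore_pgroup _ _).
rewrite sub_quotient_pre // sub_quotient_pre //; apply: prod_factor_subG => i.
have sGi := factor_subG i; have nZGi := subset_trans sGi nZG.
have nsEi := quotient_factor_normal i; have nOEi := subset_trans (normal_sub nsEi) nOE.
rewrite -sub_quotient_pre // -sub_quotient_pre //.
apply: pcore_max; last exact: quotient_normal.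
have [Q sylQ] := Sylow_exists q (Gs i); have [sQG qQ _] := and3P sylQ.
have sylQZ := quotient_pHall (subset_trans sQG nZGi) sylQ.
apply: p'quotient_Sylow nOEi sylQZ _.
have sQO := p'quotient_sub sQG (gFnorm _ _) qQ (hawGs i).
apply: subset_trans (quotientS Z sQO) _.
apply: subset_trans (morphim_pseries _ _ _) _.
have [nsNO pON] := pseries2_index p (Gs i / Z).
apply: (pseries2_normal_max _ nsNO (pcore_pgroup _ _) pON).
exact: char_normal_trans (pseries_char _ _) nsEi.
Qed.

End HypercentralProduct.

(** * The graph inclusion for the three kinds of graph *)

Theorem theorem5 (F : group_class) (k : graph_kind) (gT : finGroupType)
    (G : {group gT}) (n : nat) (Gs : 'I_n -> {group gT}) :
  formation F -> hereditary F -> contains_nilpotent F ->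
  hypercentral_product F G Gs ->
  graph_sub (Gamma k G)
    (graph_union (graph_bigunion (fun i => Gamma k (Gs i)))
                 (graph_restrict (Gamma_class k F) (fun p => p \in \pi(#|G|)))).
Proof.
move=> _ _ nilF [defG _ [Z [[hypZ _] sRZ]]]; have [nsZG _] := hypZ.
split=> [p pG | p q].
  have piGp : p \in \pi(G) by case: k pG.
  (* Every prime divisor of [|G|] is a vertex of the graph of [F], through a cyclic group of order
     p. *)
  right; split=> //; have [p_pr p_dv] : prime p /\ p %| #|G|.
    by move: piGp; rewrite mem_primes => /and3P[].
  have [x _ ox] := Cauchy p_pr p_dv.
  exists gT, <[x]>%G; split; first exact/nilF/abelian_nil/cycle_abelian.
  have: p \in \pi(#|<[x]>|) by rewrite mem_primes p_pr cardG_gt0 -orderE ox dvdnn.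
  by case: k {pG}.
case: k => /=.
- move=> edgeG; have [piGp piGq _] := edgeG; move/sylow_graphP: edgeG.
  move/(product_pq_action nsZG defG sRZ hypZ) => [[i] | [sT [S [FS]]]].
    by move/sylow_graphP; left; exists i.
  by move/sylow_graphP; right; split=> //; exists sT, S.
- move=> edgeG; have [piGp piGq _] := edgeG; move/schmidt_graphP: edgeG.
  move/(product_pq_action nsZG defG sRZ hypZ) => [[i] | [sT [S [FS]]]].
    by move/schmidt_graphP; left; exists i.
  by move/schmidt_graphP; right; split=> //; exists sT, S.
case=> piGp piGq piGOq.
have not_haw : ~~ q^'.-group (G / 'O_{p^', p}(G)) by rewrite p'groupEpi negbK.
case: (boolP [forall i, q^'.-group (Gs i / 'O_{p^', p}(Gs i))]) => [/forallP hawGs |].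
  have hawGZ := product_hawkes nsZG defG sRZ hawGs.
  have [sT [S [FS not_hawS]]] := hypercentral_hawkes hypZ hawGZ not_haw.
  by right; split=> //; exists sT, S; split=> //; apply/hawkes_graph_edge.
by rewrite negb_forall => /existsP[i not_hawGi]; left; exists i; apply/hawkes_graph_edge.
Qed.
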